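(* Let $\mathcal{D}\leq\mathbb{F}_2^n$ be a semi self-dual code. Then $$d(\mathcal{D}^{\perp})\leq\begin{cases}4\lfloor n/24\rfloor+2 & \text{if } n\equiv 0,2,4,6,8,10,12,14 \pmod{24},\\ 4\lfloor n/24\rfloor+4 & \text{if } n\equiv 16,18,20\pmod{24},\\ 4\lfloor n/24\rfloor+6 & \text{if } n\equiv 22\pmod{24}.\end{cases}$$ Moreover, if $n=24\mu$ for some integer $\mu$ and either $\mathcal{D}$ is doubly-even or $\binom{5\mu-1}{\mu-1}$ is odd, then $d(\mathcal{D}^\perp)\leq 4\mu$.
   Context: A binary linear code $\mathcal{D}\leq\mathbb{F}_2^n$ is self-orthogonal if $\mathcal{D}\subseteq\mathcal{D}^\perp$ (standard inner product). It is called semi self-dual if it is self-orthogonal, contains the all-ones vector $\mathbf{1}=(1,\dots,1)$, and $\dim(\mathcal{D}^\perp/\mathcal{D})=2$. $d(\mathcal{D}^\perp)$ denotes the minimum Hamming weight of a nonzero word of $\mathcal{D}^\perp$. $\mathcal{D}$ is doubly-even if all its codewords have weight divisible by $4$. *)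

(* Defs.v *)
(* Binary linear codes of length n are represented as row
   spaces of matrices over 'F_2 (mxalgebra, %MS). *)
From mathcomp Require Import all_boot all_order all_algebra.
Set Implicit Arguments. Unset Strict Implicit. Unset Printing Implicit Defensive.
Import GRing.Theory.
Local Open Scope ring_scope.

Definition wt n (v : 'rV['F_2]_n) : nat := #|[set j : 'I_n | v 0 j != 0]|.

(* The dual code (w.r.t. the standard inner product u *m v^T) of the code
   spanned by the rows of G : it is the row kernel of G^T. *)
Definition dualc k n (G : 'M['F_2]_(k, n)) : 'M['F_2]_n := kermx G^T.

Definition ones n : 'rV['F_2]_n := const_mx 1.

Definition self_orthogonal k n (G : 'M['F_2]_(k, n)) : bool :=
  (G <= dualc G)%MS.

Definition semi_self_dual k n (G : 'M['F_2]_(k, n)) : Prop :=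
  [/\ self_orthogonal G, (ones n <= G)%MS & (\rank (dualc G) - \rank G)%N = 2%N].

(* minimum weight of a nonzero codeword of the code spanned by C
   (defaults to n if the code is zero). *)
Definition mindist m n (C : 'M['F_2]_(m, n)) : nat :=
  \big[minn/n]_(c : 'rV['F_2]_n | (c <= C)%MS && (c != 0)) wt c.

Definition doubly_even k n (G : 'M['F_2]_(k, n)) : Prop :=
  forall c : 'rV['F_2]_n, (c <= G)%MS -> (4 %| wt c)%N.

(* the bound of the theorem (n is necessarily even) *)
Definition ssd_bound (n : nat) : nat :=
  let r := (n %% 24)%N in
  if (r <= 14)%N then (4 * (n %/ 24) + 2)%N
  else if (r <= 20)%N then (4 * (n %/ 24) + 4)%N
  else (4 * (n %/ 24) + 6)%N.

(* Main.v *)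
Require Import Defs.
From mathcomp Require Import all_boot all_order all_algebra.
From mathcomp Require Import all_field all_character ring zify.
Set Implicit Arguments. Unset Strict Implicit. Unset Printing Implicit Defensive.
Import Order.TTheory GRing.Theory Num.Theory.

(** Let [D] be the code, [n = 2 M], and let [S] be its shadow, the set of [u]
    with [u . c = wt c / 2] modulo 2 for all [c] in [D].  With
    [T u = (1 - i y)^(n - wt u) (1 + i y)^(wt u)], character sums give
      [sum_S T u = 2^(M+1) W_D]  and
      [sum_S i^M (-i)^(wt u) T u = 2^M W_{D^perp}].
    As [wt u = M] modulo 2 on [S], the combinations [W_{D^perp} + 2 W_D] and
    [W_{D^perp} - 2 W_D] are, up to sign and scaling, the sums of [T u] over the
    [u] in [S] with [wt u = M], respectively [wt u = M + 2], modulo 4.  The shadow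
    is closed under complementation, and [T u + T (u + 1)] is a nonnegative
    combination of powers of [(1 - i y)^4 (1 + i y)^4] and
    [((1 - i y)^4 - (1 + i y)^4)^2].  With [Y = y^2] this yields, for natural
    numbers [e_s] and [f_s] and [N = M - 2], the Gleason type expansions
      [2^M (W_{D^perp} + 2 W_D) = sum_s f_s (-64)^s (1+Y)^(M-4s) (Y (1-Y)^2)^s],
      [2^N (W_{D^perp} - 2 W_D)
         = - (1-6Y+Y^2) sum_s e_s (-64)^s (1+Y)^(N-4s) (Y (1-Y)^2)^s].
    If the dual distance exceeds [2 j], the left-hand sides are known up to
    [Y^j], and Lagrange inversion for [Y (1-Y)^2 / (1+Y)^4] computes [e_j] and
    [f_j]: the result has the wrong sign, is not an integer, or (when [D] is doubly
    even, so that [S = D^perp]) is nonzero although [S] is too sparse. *)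

Local Open Scope ring_scope.

(** * Lagrange inversion *)

Section Lagrange.
Variable R : numDomainType.
Implicit Types (p q r : {poly R}).

Lemma coef_mul1DXn p r k i : (i < k)%N -> (p * (1 + 'X^k * r))`_i = p`_i.
Proof.
move=> ltik; rewrite mulrDr mulr1 coefD mulrCA coefXnM ltik addr0 //.
Qed.

(* the power series [1 / (1 - 'X^2)], truncated *)
Definition geom2 j : {poly R} := \sum_(i < j.+1) 'X^(2 * i).

Lemma geom2E j : (1 - 'X^2) * geom2 j = 1 - 'X^(2 * j.+1).
Proof.
have -> : 1 - 'X^(2 * j.+1) = 1 ^+ j.+1 - ('X^2) ^+ j.+1 :> {poly R}.
  by rewrite expr1n -exprM.
rewrite subrXX; congr (_ * _); apply: eq_bigr => i _.
by rewrite expr1n mul1r exprM.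
Qed.

(* For [phi = X (1-X)^2 / (1+X)^4] one has [X phi' / phi = phi_num / (1-X^2)]. *)
Definition phi_num : {poly R} := 1 - 6%:R *: 'X + 'X^2.

(* [phi^(-m-1) phi'] is a derivative, hence has no residue at 0. *)
Lemma coef_residue_eq0 j m : (0 < m <= j)%N ->
  (phi_num * (1 + 'X) ^+ (6 * m) * geom2 j ^+ (2 * m).+1)`_m = 0.
Proof.
move=> /andP[m0 lemj].
set v := geom2 j; set E : {poly R} := 'X^(2 * j.+1).
have hv : (1 - 'X^2) * v = 1 - E by exact: geom2E.
have hv' : (1 - 'X^2) * v^`() = 2%:R * 'X * v - E^`().
  have : ((1 - 'X^2) * v)^`() = (1 - E)^`() by rewrite hv.
  rewrite derivM !derivB -!polyC1 !derivC !sub0r.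
  have -> : ('X^2)^`() = 2%:R * 'X :> {poly R} by rewrite derivXn /= expr1 mulr_natl.
  by rewrite polyC1 => <-; ring.
have hE : 'X * E^`() = (2 * j.+1)%:R * E.
  by rewrite /E derivXn -[in LHS]mulr_natl mulrCA -exprS prednK.
(* [B] would vanish for the exact series [v = 1 / (1 - X^2)]; for the truncation it is a multiple of
   the error [E]. *)
set B := 6%:R * 'X * v + 2%:R * 'X * (1 + 'X) * v^`() - (1 + 'X) * v
         + (1 + 'X) * v ^+ 2 * phi_num.
pose r' := - (2%:R * (1 + 'X) * (2 * j.+1)%:R + (1 + 'X) * v * phi_num).
have hB : (1 - 'X^2) * B = E * r'.
  have -> : (1 - 'X^2) * B = (1 - 'X^2) * v * (6%:R * 'X - (1 + 'X) +
     (1 + 'X) * v * phi_num) + 2%:R * 'X * (1 + 'X) * ((1 - 'X^2) * v^`()).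
    by rewrite /B; ring.
  rewrite hv' hv.
  have -> : 2%:R * 'X * (1 + 'X) * (2%:R * 'X * v - E^`()) =
    2%:R * 'X * (1 + 'X) * (2%:R * 'X * v) - 2%:R * (1 + 'X) * ('X * E^`()) by ring.
  rewrite hE.
  have -> : (1 - E) * (6%:R * 'X - (1 + 'X) + (1 + 'X) * v * phi_num) =
     (1 - E) * (6%:R * 'X - (1 + 'X)) + (1 - E) * ((1 + 'X) * v * phi_num) by ring.
  rewrite -{1}hv /r' /phi_num -mul_polyC; ring.
have {}hB : B = E * (r' * v + B).
  have -> : E * (r' * v + B) = (E * r') * v + E * B by ring.
  rewrite -hB; have -> : (1 - 'X^2) * B * v = ((1 - 'X^2) * v) * B by ring.
  by rewrite hv; ring.
(* [G] truncates [X^m phi^(-m)], so [X G' - m G] truncates [- m X^m phi^(-m) (X phi' / phi)], while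
   its coefficient at [X^m] is zero. *)
pose G := (1 + 'X) ^+ (6 * m) * v ^+ (2 * m).
have hG : 'X * G^`() - m%:R * G =
   m%:R * ((1 + 'X) ^+ (6 * m).-1 * v ^+ (2 * m).-1 * E * (r' * v + B))
   - m%:R * (phi_num * (1 + 'X) ^+ (6 * m) * v ^+ (2 * m).+1).
  rewrite -mulrA -mulrA -[in RHS]hB.
  rewrite /G derivM !deriv_exp derivD derivC derivX add0r.
  have [a Ea] : exists a, (6 * m)%N = a.+1 by exists (6 * m).-1; lia.
  have [b Eb] : exists b, (2 * m)%N = b.+1 by exists (2 * m).-1; lia.
  have Fa : a.+1%:R = 6%:R * m%:R :> {poly R} by rewrite -Ea natrM.
  have Fb : b.+1%:R = 2%:R * m%:R :> {poly R} by rewrite -Eb natrM.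
  rewrite Ea Eb -[_ *+ a.+1]mulr_natl -[_ *+ b.+1]mulr_natl Fa Fb /= /B.
  rewrite !(exprS (1 + 'X) a) !(exprS v b.+1) !(exprS v b).
  move: ((1 + 'X) ^+ a) (v ^+ b) v^`() (m%:R) => A1 A2 A3 A4.
  clearbody v. ring.
have := congr1 (fun q : {poly R} => q`_m) hG.
rewrite /= !coefB -!polyC_natr !coefCM.
have -> : ((1 + 'X) ^+ (6 * m).-1 * v ^+ (2 * m).-1 * E * (r' * v + B))`_m = 0.
  rewrite -mulrA mulrCA coefXnM ifT //; lia.
rewrite coefXM coef_deriv; case: (m) m0 => // m' _ /=.
rewrite mulr_natl subrr mulr0 sub0r => /esym/eqP.
by rewrite oppr_eq0 mulf_eq0 pnatr_eq0 /= => /eqP.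
Qed.

(** For [4 s <= M] this is [(1 + X)^M phi^s], written without denominators. *)
Definition phi_term M s : {poly R} :=
  (1 + 'X) ^+ (M - 4 * s) * ('X * (1 - 'X) ^+ 2) ^+ s.

(** Up to truncation the last factor is [(1 + X)^(-M) X^j phi^(-j) / (1 - X^2)]. The product is then
    [X^(j+1) phi^(s-j-1) phi'], and the coefficient is the residue of [phi^(s-j-1) phi']. *)
Lemma coef_phi_term M s j : (4 * s <= M <= 6 * j)%N ->
  (phi_num * phi_term M s * ((1 + 'X) ^+ (6 * j - M) * geom2 j ^+ (2 * j).+1))`_j
    = (s == j)%:R.
Proof.
move=> /andP[le1 le2]; set v := geom2 j.
have [ltjs|lesj] := ltnP j s.
  rewrite gtn_eqF //.
  rewrite /phi_term exprMn.
  have -> : forall a b c d : {poly R}, a * (b * ('X^s * c)) * d = 'X^s * (a * b * c * d).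
    by move=> *; ring.
  by rewrite coefXnM ltjs.
set m := (j - s)%N.
have -> : phi_num * phi_term M s * ((1 + 'X) ^+ (6 * j - M) * v ^+ (2 * j).+1) =
   'X^s * (phi_num * (1 + 'X) ^+ (6 * m) * v ^+ (2 * m).+1 * (1 - 'X^(2 * j.+1)) ^+ (2 * s)).
  rewrite -geom2E -/v.
  have -> : (2 * j).+1 = ((2 * m).+1 + 2 * s)%N by lia.
  have E : (M - 4 * s + (6 * j - M) = 6 * m + 2 * s)%N by lia.
  have -> : 1 - 'X^2 = (1 - 'X) * (1 + 'X) :> {poly R} by ring.
  rewrite /phi_term (exprMn s) -[(1 - 'X) ^+ 2 ^+ s]exprM 2!(exprMn (2 * s)).
  rewrite (exprD v).
  transitivity ('X^s * (phi_num * ((1 + 'X) ^+ (M - 4 * s + (6 * j - M))) * (1 - 'X) ^+ (2 * s) *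
    v ^+ (2 * m).+1 * v ^+ (2 * s))); first by rewrite (exprD _ (M - _)); ring.
  by rewrite E exprD; ring.
rewrite coefXnM ltnNge lesj /=.
(* The truncation only affects degrees from [2 j + 2] on. *)
have [r ->] : exists r, (1 - 'X^(2 * j.+1)) ^+ (2 * s) = 1 + 'X^(2 * j.+1) * r :> {poly R}.
  elim: (2 * s)%N => [|t [r IH]]; first by exists 0; rewrite mulr0 addr0.
  exists (r - 1 - 'X^(2 * j.+1) * r); rewrite exprS IH; ring.
rewrite coef_mul1DXn; last by lia.
have [Es|neq] := eqVneq s j; last by rewrite coef_residue_eq0 //; lia.
rewrite /m Es subnn !muln0 expr0 mulr1 expr1 -horner_coef0 hornerM /phi_num !hornerE.
rewrite /v /geom2 horner_sum big_ord_recl /= !hornerE big1 ?addr0; last first.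
  by move=> i _; rewrite hornerXn expr0n.
by ring.
Qed.

Lemma coef_phi_expansion M j (e : nat -> R) : (M <= 6 * j)%N ->
    (forall s, (M < 4 * s)%N -> e s = 0) ->
  (phi_num * (\sum_(s < (M %/ 4).+1) e s *: phi_term M s) *
     ((1 + 'X) ^+ (6 * j - M) * geom2 j ^+ (2 * j).+1))`_j = e j.
Proof.
move=> leM e0; rewrite mulr_sumr mulr_suml coef_sum.
under eq_bigr => s _.
  rewrite -scalerAr -scalerAl coefZ coef_phi_term; last by have := ltn_ord s; lia.
  over.
have [lej|ltj] := leqP (4 * j) M.
  have lt : (j < (M %/ 4).+1)%N by lia.
  rewrite (bigD1 (Ordinal lt)) //= eqxx mulr1 big1 ?addr0 // => s.
  by rewrite -val_eqE /= => /negPf->; rewrite mulr0.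
rewrite big1 ?e0 // => s _; have [Es|] := eqVneq (s : nat) j; last by rewrite mulr0.
by have := ltn_ord s; lia.
Qed.

End Lagrange.

(** * Coefficients of powers of [1 / (1 - X^2)] *)

Section Geom.
Variable R : numDomainType.
Implicit Types (p q r : {poly R}).

Lemma coef_geom2X_rec j k i : (i < 2 * j.+1)%N ->
  (geom2 R j ^+ k.+1)`_i =
    (geom2 R j ^+ k)`_i + (if (i < 2)%N then 0 else (geom2 R j ^+ k.+1)`_(i - 2)).
Proof.
move=> lti.
have : ((1 - 'X^2) * geom2 R j * geom2 R j ^+ k)`_i = (geom2 R j ^+ k)`_i.
  have := @coef_mul1DXn R (geom2 R j ^+ k) (-1) _ _ lti.
  by rewrite geom2E mulrN1 [_ * (1 - _)]mulrC => ->.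
rewrite -mulrA -exprS mulrBl mul1r coefB coefXnM => <-.
by rewrite subrK.
Qed.

(** Below the truncation order this is the negative binomial series, by Pascal's rule. *)
Lemma coef_geom2X j k i : (i < 2 * j.+1)%N ->
  (geom2 R j ^+ k.+1)`_i = if odd i then 0 else 'C(k + i./2, i./2)%:R.
Proof.
elim: k i => [|k IHk] i; elim/ltn_ind: i => i IHi lti; rewrite coef_geom2X_rec //.
  rewrite expr0 coef1; case: i IHi lti => [|[|i]] IHi lti /=; rewrite ?addr0 //.
  by rewrite add0r subn2 /= IHi ?negbK; [case: ifP; rewrite // !binn | lia | lia].
rewrite IHk //; case: i IHi lti => [|[|i]] IHi lti /=; rewrite ?addr0 ?bin0 //.
rewrite subn2 /= IHi; [|lia|lia]; rewrite negbK; case: ifP => _; first by rewrite addr0.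
by rewrite -natrD [in RHS]addSn binS addSnnS.
Qed.

Definition nncoef p := forall i, 0 <= p`_i.

Lemma nncoefX1D p : nncoef p -> nncoef ((1 + 'X) * p).
Proof.
move=> p0 i; rewrite mulrDl mul1r coefD coefXM addr_ge0 //.
by case: ifP.
Qed.

Lemma nncoef_geom2X j k : nncoef (geom2 R j ^+ k).
Proof.
elim: k => [|k IH] i; first by rewrite expr0 coef1 ler0n.
rewrite exprSr coefM sumr_ge0 // => s _; rewrite mulr_ge0 //.
by rewrite /geom2 coef_sum sumr_ge0 // => t _; rewrite coefXn ler0n.
Qed.

Lemma nncoefX1DX p d : nncoef p -> nncoef ((1 + 'X) ^+ d * p).
Proof.
move=> p0; elim: d => [|d IH]; first by rewrite mul1r.
by rewrite exprS -mulrA; apply: nncoefX1D.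
Qed.

Lemma coef_X1DX_ge p d i : nncoef p -> p`_i <= ((1 + 'X) ^+ d * p)`_i.
Proof.
move=> p0; elim: d => [|d IH]; first by rewrite mul1r.
rewrite exprS -mulrA mulrDl mul1r coefD coefXM; apply: (le_trans IH).
rewrite lerDl; case: ifP => // _; exact: nncoefX1DX.
Qed.

(** The power of [geom2] has positive even coefficients and zero odd ones; a single factor [1 + X]
    fills in the latter. *)
Lemma coef_X1DX_geom2_gt0 d j k i : (i < 2 * j.+1)%N -> ~~ odd i || (0 < d)%N ->
  0 < ((1 + 'X) ^+ d * geom2 R j ^+ k.+1)`_i.
Proof.
have g0 := nncoef_geom2X j k.+1.
have even_gt0 b : (b < 2 * j.+1)%N -> ~~ odd b -> 0 < (geom2 R j ^+ k.+1)`_b.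
  by move=> ltb /negPf ob; rewrite coef_geom2X // ob ltr0n bin_gt0 leq_addl.
move=> lti; have [oi|ei _] := boolP (odd i); last first.
  exact: lt_le_trans (even_gt0 _ lti ei) (coef_X1DX_ge _ _ g0).
case: d => // d _; case: i lti oi => // i lti oi.
rewrite exprS -mulrA mulrDl mul1r coefD coefXM /= ltr_wpDl //.
  exact: nncoefX1DX.
by apply: lt_le_trans (coef_X1DX_ge _ _ g0); apply: even_gt0 => //; lia.
Qed.

(** The ratio 5 is ['C(5 m, m) = 5 'C(5 m - 1, m - 1)]. The binomial coefficient of the theorem
    enters here. *)
Lemma coef_geom2X_diag m : (0 < m)%N ->
  let g := geom2 R (2 * m) ^+ (2 * (2 * m)).+1 in
  g`_(2 * m - 2) = 'C(5 * m - 1, m - 1)%:R /\ g`_(2 * m) = 5%:R * g`_(2 * m - 2).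
Proof.
move=> m0 /=.
have -> : (geom2 R (2 * m) ^+ (2 * (2 * m)).+1)`_(2 * m - 2) = 'C(5 * m - 1, m - 1)%:R.
  rewrite coef_geom2X; last by lia.
  rewrite ifN; last by lia.
  by congr ('C(_, _)%:R); lia.
split=> //; rewrite coef_geom2X; last by lia.
rewrite ifN; last by lia.
have -> : (2 * m)./2 = m by lia.
have -> : (2 * (2 * m) + m = 5 * m)%N by lia.
rewrite -natrM; congr (_%:R); apply/eqP; rewrite -(eqn_pmul2l m0); apply/eqP.
have := mul_bin_diag (5 * m) m.-1; rewrite prednK // => <-.
by rewrite !subn1 mulnA [(m * 5)%N]mulnC.
Qed.

(** The middle term of [(1 + X)^2] meets a zero odd coefficient; the outer ones contribute
    [5 + 1]. *)
Lemma coef_X1D2_geom2 m : (0 < m)%N ->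
  ((1 + 'X) ^+ 2 * geom2 R (2 * m) ^+ (2 * (2 * m)).+1)`_(2 * m)
    = 6%:R * 'C(5 * m - 1, m - 1)%:R.
Proof.
move=> m0; have /= [<- g0] := coef_geom2X_diag m0.
move: g0; set g := _ ^+ _.+1 => g0.
have -> : (1 + 'X) ^+ 2 * g = g + 2%:R *: ('X * g) + 'X^2 * g.
  by rewrite -mul_polyC; ring.
rewrite !coefD coefZ coefXM coefXnM !ifN; [|lia|lia].
have -> : g`_(2 * m).-1 = 0 by rewrite /g coef_geom2X ?ifT //; lia.
by rewrite g0; ring.
Qed.

(** In the expansion of [phi_num (1 + X)^d] only even powers contribute. The constant term yields
    [5 a 2], which is outweighed by the coefficient -10, -14 or -17 of [X^2]; the rest is controlled
    by [a 6 <= a 4 <= a 2]. The cases [d = 4, 3, 2] correspond to [n = 16, 18, 20] modulo 24. *)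
Lemma coef_phi_num_geom2_lt0 d m : (0 < m)%N -> (2 <= d <= 4)%N ->
  (phi_num R * ((1 + 'X) ^+ d * geom2 R (2 * m) ^+ (2 * (2 * m)).+1))`_(2 * m) < 0.
Proof.
move=> m0 d24; have /= [g2 g0] := coef_geom2X_diag m0.
move: g0 g2; set g := _ ^+ _.+1 => g0 g2.
pose a i := ('X^i * g)`_(2 * m).
have a0 : a 0%N = 5%:R * a 2%N.
  by rewrite /a mul1r g0 coefXnM ifN //; lia.
have a2 : 0 < a 2%N.
  by rewrite /a coefXnM ifN ?g2 ?ltr0n ?bin_gt0; lia.
have aodd i : odd i -> a i = 0.
  move=> oi; rewrite /a coefXnM; case: ifP => // ltmi.
  by rewrite /g coef_geom2X ?ifT //; lia.
have ale i : a i.+2 <= a i.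
  rewrite /a !coefXnM; case: ifP => lt1.
    by case: ifP => // _; apply: nncoef_geom2X.
  rewrite ifN; last by lia.
  rewrite [leRHS]coef_geom2X_rec; last by lia.
  rewrite ifN; last by lia.
  have -> : (2 * m - i - 2 = 2 * m - i.+2)%N by lia.
  by rewrite lerDr; apply: nncoef_geom2X.
have a6 : 0 <= a 6%N.
  by rewrite /a coefXnM; case: ifP => // _; apply: nncoef_geom2X.
have aE i : ('X^i * g)`_(2 * m) = a i by [].
have [a1 a3 a5] : [/\ a 1%N = 0, a 3%N = 0 & a 5%N = 0] by split; apply: aodd.
have a42 : a 4%N <= a 2%N := ale 2%N.
have a64 : a 6%N <= a 4%N := ale 4%N.
have a4 : 0 <= a 4%N := le_trans a6 a64.
have : d = 2 \/ d = 3 \/ d = 4 by lia.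
case=> [|[|]] ->.
- have -> : phi_num R * ((1 + 'X) ^+ 2 * g) = 'X^0 * g - 4%:R *: ('X^1 * g)
    - 10%:R *: ('X^2 * g) - 4%:R *: ('X^3 * g) + 'X^4 * g by rewrite /phi_num -!mul_polyC; ring.
  rewrite !(coefD, coefN, coefZ) !aE a0 a1 a3 !mulr0.
  rewrite [ltLHS](_ : _ = - (4%:R * a 2%N + (a 2%N - a 4%N))); last by ring.
  by rewrite oppr_lt0 ltr_pwDl ?mulr_gt0 ?subr_ge0 ?addr_ge0 ?subr_ge0 ?mulr_ge0 ?ltr0n ?ler0n.
- have -> : phi_num R * ((1 + 'X) ^+ 3 * g) = 'X^0 * g - 3%:R *: ('X^1 * g)
    - 14%:R *: ('X^2 * g) - 14%:R *: ('X^3 * g) - 3%:R *: ('X^4 * g) + 'X^5 * g.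
    by rewrite /phi_num -!mul_polyC; ring.
  rewrite !(coefD, coefN, coefZ) !aE a0 a1 a3 a5 !mulr0.
  rewrite [ltLHS](_ : _ = - (9%:R * a 2%N + 3%:R * a 4%N)); last by ring.
  by rewrite oppr_lt0 ltr_pwDl ?mulr_gt0 ?subr_ge0 ?addr_ge0 ?subr_ge0 ?mulr_ge0 ?ltr0n ?ler0n.
- have -> : phi_num R * ((1 + 'X) ^+ 4 * g) = 'X^0 * g - 2%:R *: ('X^1 * g)
    - 17%:R *: ('X^2 * g) - 28%:R *: ('X^3 * g) - 17%:R *: ('X^4 * g)
    - 2%:R *: ('X^5 * g) + 'X^6 * g.
    by rewrite /phi_num -!mul_polyC; ring.
  rewrite !(coefD, coefN, coefZ) !aE a0 a1 a3 a5 !mulr0.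
  rewrite [ltLHS](_ : _ = - (12%:R * a 2%N + (16%:R * a 4%N + (a 4%N - a 6%N)))); last by ring.
  rewrite oppr_lt0 ltr_pwDl ?mulr_gt0 ?ltr0n //.
  by apply: addr_ge0; rewrite ?subr_ge0 // mulr_ge0 ?ler0n.
Qed.

End Geom.

(** * Cones of homogeneous polynomials *)

Section HomCone.
Variables (A : comNzRingType) (p D : A).

(** Natural coefficients retain both sign, for the bounds, and integrality, for the parity
    argument. *)
Definition hom_cone m (F : A) : Prop :=
  exists e : nat -> nat, F = \sum_(s < m.+1) (e s)%:R * (p ^+ (m - s) * D ^+ s).

Lemma hom_coneD m F1 F2 : hom_cone m F1 -> hom_cone m F2 -> hom_cone m (F1 + F2).
Proof.
move=> [e1 ->] [e2 ->]; exists (fun s => e1 s + e2 s)%N.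
by rewrite -big_split /=; apply: eq_bigr => s _; rewrite natrD mulrDl.
Qed.

Lemma hom_cone_nat (k : nat) : hom_cone 0 k%:R.
Proof. by exists (fun=> k); rewrite big_ord1 !mulr1. Qed.

Lemma hom_coneMl m F : hom_cone m F -> hom_cone m.+1 (p * F).
Proof.
move=> [e ->]; exists (fun s => if (s <= m)%N then e s else 0%N).
rewrite [RHS]big_ord_recr /= ltnn mul0r addr0 mulr_sumr; apply: eq_bigr => s _.
by rewrite -ltnS ltn_ord subSn 1?exprS -1?ltnS //; ring.
Qed.

Lemma hom_coneMr m F : hom_cone m F -> hom_cone m.+1 (D * F).
Proof.
move=> [e ->]; exists (fun s => if s is s'.+1 then e s' else 0%N).
rewrite [RHS]big_ord_recl /= mul0r add0r mulr_sumr; apply: eq_bigr => s _.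
by rewrite /bump /= add1n subSS exprS; ring.
Qed.

Variables (B : comNzRingType) (f : {rmorphism A -> B}) (a b : B).
Hypotheses (fp : f p = a * b) (fD : f D = (a - b) ^+ 2).

(** The two-term recurrence for [a^(2m) + b^(2m)] involves a subtraction. Coupling with [W] replaces
    it by two recurrences with positive coefficients in [p] and [D]. *)
Lemma even_power_sum_cone m :
  exists2 V, hom_cone m V & f V = a ^+ (2 * m) + b ^+ (2 * m).
Proof.
suff [V [W [cV _ fV _]]] : exists V W, [/\ hom_cone m V, hom_cone m.+1 W,
    f V = a ^+ (2 * m) + b ^+ (2 * m) &
    f W = (a - b) * (a ^+ (2 * m).+1 - b ^+ (2 * m).+1)] by exists V.
elim: m => [|m [V [W [cV cW fV fW]]]].
  exists 2%:R, (D * 1%:R); split; [exact: hom_cone_nat| | |].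
  - exact/hom_coneMr/hom_cone_nat.
  - by rewrite rmorph_nat !expr0.
  - by rewrite mulr1 fD !expr1.
have cV' : hom_cone m.+1 (p * V + W) by apply: hom_coneD => //; apply: hom_coneMl.
exists (p * V + W), (D * (p * V + W) + p * W); split=> //.
- by apply: hom_coneD; [apply: hom_coneMr | apply: hom_coneMl].
- by rewrite rmorphD rmorphM /= fp fV fW mulnS /= !exprS; ring.
- by rewrite !(rmorphD, rmorphM) /= fp fD fV fW mulnS /= !exprS; ring.
Qed.

(** The same coupled induction; the factor [a + b] stays outside because only its square [D + 4 p]
    comes from [p] and [D]. *)
Lemma odd_power_sum_cone m :
  exists2 V, hom_cone m V & (a + b) * f V = a ^+ (2 * m).+1 + b ^+ (2 * m).+1.
Proof.
suff [V [W [cV _ fV _]]] : exists V W, [/\ hom_cone m V, hom_cone m W,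
    (a + b) * f V = a ^+ (2 * m).+1 + b ^+ (2 * m).+1 &
    (a + b) * f W = (a - b) * (a ^+ (2 * m) - b ^+ (2 * m))] by exists V.
elim: m => [|m [V [W [cV cW fV fW]]]].
  exists 1%:R, 0%:R; split; try exact: hom_cone_nat.
  - by rewrite rmorph_nat mulr1 !expr1.
  - by rewrite rmorph_nat !expr0 subrr !mulr0.
have cW' : hom_cone m.+1 (D * V + p * W).
  by apply: hom_coneD; [apply: hom_coneMr | apply: hom_coneMl].
have fW' : (a + b) * f (D * V + p * W) = (a - b) ^+ 2 * (a ^+ (2 * m).+1 + b ^+ (2 * m).+1)
    + a * b * ((a - b) * (a ^+ (2 * m) - b ^+ (2 * m))).
  by rewrite -fV -fW !(rmorphD, rmorphM) /= fp fD; ring.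
exists (p * V + (D * V + p * W)), (D * V + p * W); split=> //.
- by apply: hom_coneD => //; apply: hom_coneMl.
- rewrite rmorphD rmorphM /= mulrDr fp fW' mulrCA fV mulnS /= !exprS; ring.
- by rewrite fW' mulnS /= !exprS; ring.
Qed.

End HomCone.

(** * Expansions in [(1 + X)^N phi^s] with signed natural coefficients *)

Section PhiCone.
Variable R : numDomainType.

(** The index [k] bounds the support separately from [N], since a sparse shadow makes the high
    coefficients vanish. *)
Definition phi_cone N k (F : {poly R}) : Prop :=
  exists2 e : nat -> nat, forall s, (k < s)%N -> e s = 0%N &
    F = \sum_(s < (N %/ 4).+1) ((- 64%:R) ^+ s * (e s)%:R) *: phi_term R N s.

Lemma phi_cone0 N k : phi_cone N k 0.
Proof.
by exists (fun=> 0%N) => //; rewrite big1 // => s _; rewrite mulr0 scale0r.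
Qed.

Lemma phi_coneD N k F1 F2 : phi_cone N k F1 -> phi_cone N k F2 -> phi_cone N k (F1 + F2).
Proof.
move=> [e1 h1 ->] [e2 h2 ->]; exists (fun s => e1 s + e2 s)%N.
  by move=> s lts; rewrite h1 ?h2.
by rewrite -big_split /=; apply: eq_bigr => s _; rewrite natrD mulrDr scalerDl.
Qed.

Lemma hom_cone_phi N m k (F : {poly R}) : (4 * m <= N)%N -> (m <= k)%N ->
  hom_cone ((1 + 'X) ^+ 4) (- 64%:R *: ('X * (1 - 'X) ^+ 2)) m F ->
  phi_cone N k ((1 + 'X) ^+ (N - 4 * m) * F).
Proof.
move=> lem lek [e ->]; exists (fun s => if (s <= m)%N then e s else 0%N).
  by move=> s lts; rewrite ifN //; lia.
have leN : (m.+1 <= (N %/ 4).+1)%N by lia.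
rewrite mulr_sumr (big_ord_widen _ (fun s => (1 + 'X) ^+ (N - 4 * m) * ((e s)%:R *
  ((1 + 'X) ^+ 4 ^+ (m - s) * (- 64%:R *: ('X * (1 - 'X) ^+ 2)) ^+ s))) leN).
rewrite big_mkcond; apply: eq_bigr => s _ /=; rewrite ltnS.
case: ifP => lts; last by rewrite mulr0 scale0r.
rewrite /phi_term exprZn -exprM.
have -> : (N - 4 * s = N - 4 * m + 4 * (m - s))%N by lia.
rewrite exprD -!mul_polyC polyCM polyC_natr; ring.
Qed.

Lemma coef_phi_cone N k j F : (N <= 6 * j)%N -> (4 * k <= N)%N -> phi_cone N k F ->
  exists e : nat, ((k < j)%N -> e = 0%N) /\
   (phi_num R * F * ((1 + 'X) ^+ (6 * j - N) * geom2 R j ^+ (2 * j).+1))`_j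
    = (- 64%:R) ^+ j * e%:R.
Proof.
move=> leN lek [e e0 ->]; exists (e j); split; first exact: e0.
rewrite (@coef_phi_expansion R N j (fun s => (- 64%:R) ^+ s * (e s)%:R)) // => s lts.
by rewrite e0 ?mulr0 //; lia.
Qed.

End PhiCone.

(** * Weight enumerators and the shadow *)

Lemma cards_zeros n (v : 'rV['F_2]_n) : #|[set j | v 0 j == 0]| = (n - wt v)%N.
Proof.
have := cardsC [set j | v 0 j != 0]; rewrite card_ord -/(wt v) => E.
rewrite -[X in (X - _)%N]E addKn; by apply: eq_card => j; rewrite !inE negbK.
Qed.

Section Characters.
Variable L : comNzRingType.

Lemma F2P (a : 'F_2) : a = 0 \/ a = 1.
Proof. by case: a => -[|[|//]] lt; [left|right]; apply: val_inj. Qed.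

Definition chi (a : 'F_2) : L := if a == 0 then 1 else -1.

Lemma chi0 : chi 0 = 1. Proof. by rewrite /chi eqxx. Qed.

Lemma chiD a b : chi (a + b) = chi a * chi b.
Proof. by case: (F2P a) (F2P b) => -> [] ->; rewrite /chi /= ?mulr1 ?mul1r ?mulrNN ?mulr1. Qed.

Definition dot n (u v : 'rV['F_2]_n) : 'F_2 := \sum_j u 0 j * v 0 j.

Lemma dotC n (u v : 'rV['F_2]_n) : dot u v = dot v u.
Proof. by apply: eq_bigr => j _; rewrite mulrC. Qed.

Lemma dotDr n (u v w : 'rV['F_2]_n) : dot u (v + w) = dot u v + dot u w.
Proof. by rewrite -big_split; apply: eq_bigr => j _; rewrite mxE mulrDr. Qed.

Lemma dotDl n (u v w : 'rV['F_2]_n) : dot (u + v) w = dot u w + dot v w.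
Proof. by rewrite dotC dotDr !(dotC w). Qed.

Lemma chi_dot n (u v : 'rV['F_2]_n) : chi (dot u v) = \prod_j chi (u 0 j * v 0 j).
Proof. exact: (big_morph chi chiD chi0). Qed.

(** Distributivity; it reduces each character sum below to one coordinate. *)
Lemma sum_prod_rV n (F : 'I_n -> 'F_2 -> L) :
  \sum_(u : 'rV['F_2]_n) \prod_j F j (u 0 j) = \prod_j (F j 0 + F j 1).
Proof.
have sum2 (f : 'F_2 -> L) : \sum_a f a = f 0 + f 1.
  rewrite (bigD1 0) //= (bigD1 1) //= big1 ?addr0 // => a /andP[].
  by case: (F2P a) => ->; rewrite eqxx.
under [RHS]eq_bigr do rewrite -sum2.
rewrite bigA_distr_bigA /=.
rewrite (reindex (fun f : {ffun 'I_n -> 'F_2} => \row_j f j)) /=; last first.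
  exists (fun u : 'rV_n => [ffun j => u 0 j]) => u _.
    by apply/ffunP=> j; rewrite ffunE mxE.
  by apply/rowP=> j; rewrite mxE ffunE.
by apply: eq_bigr => f _; apply: eq_bigr => j _; rewrite mxE.
Qed.

Lemma prod_wt n (v : 'rV['F_2]_n) (a b : L) :
  \prod_j (if v 0 j == 0 then a else b) = a ^+ (n - wt v) * b ^+ wt v.
Proof.
rewrite (bigID (fun j => v 0 j == 0)) /=; congr (_ * _).
  rewrite (eq_bigr (fun=> a)) => [|j ->] //; rewrite prodr_const; congr (_ ^+ _).
  by rewrite -cards_zeros cardsE.
rewrite (eq_bigr (fun=> b)) => [|j /negPf->] //; rewrite prodr_const.
by congr (_ ^+ _); rewrite /wt cardsE.
Qed.

Lemma wt_le n (v : 'rV['F_2]_n) : (wt v <= n)%N.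
Proof. by rewrite -[leqRHS]card_ord max_card. Qed.

Lemma chi_dot_ones n (v : 'rV['F_2]_n) : chi (dot v (ones n)) = (-1) ^+ wt v.
Proof.
have := prod_wt v 1 (-1); rewrite expr1n mul1r chi_dot => <-.
by apply: eq_bigr => j _; rewrite mxE mulr1.
Qed.

Lemma chi_dot_diag n (v : 'rV['F_2]_n) : chi (dot v v) = (-1) ^+ wt v.
Proof.
rewrite -chi_dot_ones; congr chi; apply: eq_bigr => j _; rewrite mxE mulr1.
by case: (F2P (v 0 j)) => ->; rewrite ?mulr0 ?mulr1.
Qed.

Lemma wtD_ones n (v : 'rV['F_2]_n) : wt (v + ones n) = (n - wt v)%N.
Proof.
rewrite -cards_zeros; apply: eq_card => j; rewrite !inE !mxE.
by case: (F2P (v 0 j)) => ->.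
Qed.

(* [wt (c + d) = wt c + wt d - 2 |c /\ d|] *)
Lemma exp_wtD n (c d : 'rV['F_2]_n) (x : L) : x ^+ 2 = -1 ->
  x ^+ wt (c + d) * chi (dot c d) = x ^+ wt c * x ^+ wt d.
Proof.
move=> x2.
have E (v : 'rV['F_2]_n) : x ^+ wt v = \prod_j (if v 0 j == 0 then 1 else x).
  by rewrite prod_wt expr1n mul1r.
rewrite !E chi_dot -!big_split /=; apply: eq_bigr => j _; rewrite mxE.
case: (F2P (c 0 j)) (F2P (d 0 j)) => -> [] ->; rewrite /chi /= ?mulr1 ?mul1r //.
Qed.

End Characters.

Lemma sub_dualcP k n (G : 'M['F_2]_(k, n)) (v : 'rV_n) :
  reflect (forall c : 'rV_n, (c <= G)%MS -> dot v c = 0) (v <= dualc G)%MS.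
Proof.
have dotE (u w : 'rV['F_2]_n) : dot u w = (u *m w^T) 0 0.
  by rewrite mxE; apply: eq_bigr => j _; rewrite mxE.
apply: (iffP sub_kermxP) => [vG c /submxP[x ->] | H].
  by rewrite dotE trmx_mul mulmxA vG mul0mx mxE.
apply/rowP => i; rewrite [RHS]mxE -[RHS](H _ (row_sub i G)) mxE.
by apply: eq_bigr => j _; rewrite !mxE.
Qed.

Lemma mindist_le m n (C : 'M['F_2]_(m, n)) c :
  (c <= C)%MS -> c != 0 -> (mindist C <= wt c)%N.
Proof.
move=> cC c0; rewrite /mindist; have := mem_index_enum c.
elim: (index_enum _) => // d s IH; rewrite inE big_cons.
case/orP=> [/eqP <-|/IH le]; first by rewrite cC c0 geq_minl.
by case: ifP => // _; rewrite geq_min le orbT.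
Qed.

(** * Character sums over the shadow and the dual code *)

Section Shadow.
Variables (K : numClosedFieldType) (k n : nat) (G : 'M['F_2]_(k, n)).
Notation L := {poly K}.
Hypothesis soG : self_orthogonal G.

Let I : L := ('i : K)%:P.
Let I2 : I ^+ 2 = -1.
Proof. by rewrite /I -polyC_exp sqrCi polyCN. Qed.

Let dotG c d : (c <= G)%MS -> (d <= G)%MS -> dot c d = 0.
Proof. by move=> cG; apply/sub_dualcP; apply: submx_trans cG soG. Qed.

Definition codewords m (C : 'M['F_2]_(m, n)) := [set c : 'rV['F_2]_n | (c <= C)%MS].

Lemma card_codewords m (C : 'M['F_2]_(m, n)) : #|codewords C| = (2 ^ \rank C)%N.
Proof.
by have := card_rowg C; rewrite card_Fp // => <-.
Qed.

(** As [d + d = 0], the values are 1 and -1; translation by a word of value -1 negates the sum. *)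
Lemma sum_character (f : 'rV['F_2]_n -> L) : f 0 = 1 ->
    (forall c d, c \in codewords G -> d \in codewords G -> f (c + d) = f c * f d) ->
  \sum_(c in codewords G) f c =
    if [forall c in codewords G, f c == 1] then (2 ^ \rank G)%:R else 0.
Proof.
move=> f0 fD; case: ifPn => [/forall_inP f1|].
  rewrite (eq_bigr (fun=> 1)) => [|c cG]; last by apply/eqP/f1.
  by rewrite sumr_const card_codewords.
case/forall_inPn => d dG fd1.
have fd : f d = -1.
  have : f d ^+ 2 = 1.
    rewrite expr2 -fD // -f0; congr f; apply/rowP=> j; rewrite !mxE.
    by case: (F2P (d 0 j)) => ->; apply: val_inj.
  by move/eqP; rewrite sqrf_eq1 (negPf fd1) => /eqP.
set s := \sum_(c in _) _.
have : s = - s.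
  rewrite {1}/s (reindex (fun c => d + c)) /=; last first.
    by exists (fun c => c - d) => c _; rewrite addrC ?addKr ?subrK.
  rewrite -mulN1r mulr_sumr; apply: eq_big => c.
    rewrite !inE; rewrite inE in dG; apply/idP/idP => cG; last exact: addmx_sub.
    by rewrite -(addKr d c) addmx_sub // -scaleN1r scalemx_sub.
  move=> cG; rewrite -fd -fD //; rewrite !inE in cG dG *.
  by rewrite -(addKr d c) addmx_sub // -scaleN1r scalemx_sub.
move/eqP; rewrite -addr_eq0 -mulr2n -scaler_nat scaler_eq0 pnatr_eq0 /=.
by move/eqP.
Qed.

(* The shadow: [u . c = wt c / 2] modulo 2 for all [c] in the code *)
Definition shadow := [set u : 'rV['F_2]_n |
  [forall c in codewords G, chi L (dot u c) * I ^+ wt c == 1]].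

Definition wenum m (C : 'M['F_2]_(m, n)) : L := \sum_(c in codewords C) 'X^(wt c).

Definition shadow_term (u : 'rV['F_2]_n) : L :=
  (1 - I * 'X) ^+ (n - wt u) * (1 + I * 'X) ^+ wt u.

(** By self-orthogonality and [exp_wtD], [c -> chi (u . c) i^(wt c)] is a character of the code,
    trivial exactly when [u] lies in the shadow. *)
Lemma sum_shadow (g : 'rV['F_2]_n -> L) :
  (2 ^ \rank G)%:R * (\sum_(u in shadow) g u) =
  \sum_(c in codewords G) I ^+ wt c * \sum_u chi L (dot u c) * g u.
Proof.
transitivity (\sum_u \sum_(c in codewords G) chi L (dot u c) * I ^+ wt c * g u).
  rewrite [in LHS]big_mkcond mulr_sumr; apply: eq_bigr => u _.
  rewrite -mulr_suml (@sum_character (fun c => chi L (dot u c) * I ^+ wt c)).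
  - by rewrite inE; case: ifP => _; rewrite ?mulr0 ?mul0r.
  - rewrite /dot big1 => [|j _]; last by rewrite mxE mulr0.
    by rewrite chi0 mul1r /wt eq_card0 // => j; rewrite !inE mxE eqxx.
  move=> c d; rewrite !inE => cG dG; rewrite dotDr chiD.
  have := exp_wtD c d I2; rewrite dotG // chi0 mulr1 => ->; ring.
rewrite exchange_big; apply: eq_bigr => c _; rewrite mulr_sumr.
by apply: eq_bigr => u _; ring.
Qed.

Lemma sum_shadow_term : (2 ^ \rank G)%:R * (\sum_(u in shadow) shadow_term u) =
  (2 ^ n)%:R * wenum G.
Proof.
rewrite sum_shadow mulr_sumr; apply: eq_bigr => c _.
have E u : chi L (dot u c) * shadow_term u =
    \prod_j (chi L (u 0 j * c 0 j) * (if u 0 j == 0 then 1 - I * 'X else 1 + I * 'X)).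
  by rewrite big_split /= -chi_dot prod_wt.
under eq_bigr do rewrite E.
rewrite (sum_prod_rV (fun j a => chi L (a * c 0 j) * (if a == 0 then 1 - I * 'X else 1 + I * 'X))).
(* Sum and difference of [1 - i y] and [1 + i y]; the factor [i] then turns [- 2 i y] into [2 y]. *)
transitivity (I ^+ wt c * \prod_j (if c 0 j == 0 then 2%:R else - (2%:R * I * 'X))).
  congr (_ * _); apply: eq_bigr => j _; rewrite mul0r mul1r chi0 eqxx /= mul1r /chi.
  by case: ifP => _; ring.
have -> : (2 ^ n)%:R = 2%:R ^+ (n - wt c) * 2%:R ^+ wt c :> L.
  by rewrite -exprD subnK ?wt_le // natrX.
rewrite prod_wt -[in RHS]mulrA -exprMn mulrCA -exprMn; congr (_ * _ ^+ _).
transitivity (- (2%:R * I ^+ 2 * 'X)); first by ring.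
by rewrite I2; ring.
Qed.

Lemma macwilliams : (2 ^ \rank G)%:R * wenum (dualc G) =
  \sum_(c in codewords G) (1 + 'X) ^+ (n - wt c) * (1 - 'X) ^+ wt c.
Proof.
transitivity (\sum_(v : 'rV['F_2]_n) \sum_(c in codewords G) chi L (dot v c) * 'X^(wt v)).
  rewrite /wenum mulr_sumr big_mkcond; apply: eq_bigr => v _.
  rewrite -mulr_suml (@sum_character (fun c => chi L (dot v c))).
  - have -> : [forall c in codewords G, chi L (dot v c) == 1] = (v \in codewords (dualc G)).
      rewrite inE; apply/forall_inP/sub_dualcP => H c cG.
        have := H c; rewrite inE => /(_ cG); rewrite /chi; case: ifPn => [/eqP //|_].
        by rewrite eq_sym -addr_eq0 -mulr2n -polyC_natr polyC_eq0 pnatr_eq0.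
      by rewrite inE in cG; rewrite H ?chi0.
    by case: ifP => _; rewrite ?mul0r.
  - by rewrite /dot big1 ?chi0 // => j _; rewrite mxE mulr0.
  by move=> c d _ _; rewrite dotDr chiD.
rewrite exchange_big; apply: eq_bigr => c _.
have E v : chi L (dot v c) * 'X^(wt v) =
    \prod_j (chi L (v 0 j * c 0 j) * (if v 0 j == 0 then 1 else 'X)).
  by rewrite big_split /= -chi_dot prod_wt expr1n mul1r.
under eq_bigr do rewrite E.
rewrite (sum_prod_rV (fun j a => chi L (a * c 0 j) * (if a == 0 then 1 else 'X))).
rewrite -prod_wt; apply: eq_bigr => j _; rewrite mul0r mul1r chi0 eqxx /= /chi.
by case: ifP => _; ring.
Qed.

(** The twist makes the coordinate sums [(1 - i) (1 + y)] and [(1 + i) (1 - y)], those of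
    [macwilliams] up to constants. Since [i (1 + i) = - (1 - i)], the constants multiply to
    [(1 - i)^n], the sign vanishing as codewords have even weight. *)
Lemma sum_shadow_twist :
  \sum_(u in shadow) (- I) ^+ wt u * shadow_term u = (1 - I) ^+ n * wenum (dualc G).
Proof.
have r0 : (2 ^ \rank G)%:R != 0 :> L.
  by rewrite -polyC_natr polyC_eq0 pnatr_eq0 expn_eq0.
apply: (mulfI r0); rewrite sum_shadow mulrCA macwilliams mulr_sumr.
apply: eq_bigr => c cG.
have E u : chi L (dot u c) * ((- I) ^+ wt u * shadow_term u) =
    \prod_j (chi L (u 0 j * c 0 j) * (if u 0 j == 0 then 1 - I * 'X else - I * (1 + I * 'X))).
  by rewrite big_split /= -chi_dot prod_wt exprMn /shadow_term; ring.
under eq_bigr do rewrite E.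
rewrite (sum_prod_rV (fun j a => chi L (a * c 0 j) *
  (if a == 0 then 1 - I * 'X else - I * (1 + I * 'X)))).
transitivity (I ^+ wt c * \prod_j (if c 0 j == 0 then (1 - I) * (1 + 'X) else (1 + I) * (1 - 'X))).
  congr (_ * _); apply: eq_bigr => j _; rewrite mul0r mul1r chi0 eqxx /= mul1r /chi.
  have -> : - I * (1 + I * 'X) = - I - I ^+ 2 * 'X by ring.
  by rewrite I2; case: ifP => _; ring.
have ev : (-1) ^+ wt c = 1 :> L.
  by rewrite -chi_dot_diag; rewrite inE in cG; rewrite dotG ?chi0.
have -> : (1 - I) ^+ n = (1 - I) ^+ (n - wt c) * (1 - I) ^+ wt c.
  by rewrite -exprD subnK ?wt_le.
rewrite prod_wt !exprMn.
have -> : forall a b d e f : L, a * (b * d * (e * f)) = b * (a * e) * (d * f) by move=> *; ring.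
rewrite -exprMn; congr (_ * _ * _).
have -> : I * (1 + I) = (-1) * (1 - I) by rewrite mulrDr -expr2 I2; ring.
by rewrite exprMn ev mul1r.
Qed.


(** * Gleason type expansions *)

Let t : L := I * 'X.
Let t2 : t ^+ 2 = - 'X^2.
Proof. by rewrite exprMn I2 mulN1r. Qed.

(** This and the next fact are the cone hypotheses for [a = (1 - t)^4], [b = (1 + t)^4] and the
    substitution [Y = y^2]. *)
Let fp : ((1 + 'X) ^+ 4 : L) \Po 'X^2 = (1 - t) ^+ 4 * (1 + t) ^+ 4.
Proof.
have -> : (1 - t) ^+ 4 * (1 + t) ^+ 4 = (1 - t ^+ 2) ^+ 4 by ring.
by rewrite t2 opprK rmorphXn /= comp_polyD comp_polyX comp_polyC.
Qed.

Let fD : (- 64%:R *: ('X * (1 - 'X) ^+ 2) : L) \Po 'X^2 = ((1 - t) ^+ 4 - (1 + t) ^+ 4) ^+ 2.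
Proof.
have -> : ((1 - t) ^+ 4 - (1 + t) ^+ 4) ^+ 2 = 64%:R * t ^+ 2 * (1 + t ^+ 2) ^+ 2 by ring.
rewrite t2 comp_polyZ comp_polyM rmorphXn /= comp_polyB comp_polyX comp_polyC -mul_polyC.
by rewrite polyCN polyC_natr; ring.
Qed.

Let f_phi : (phi_num K \Po 'X^2) *+ 2 = (1 - t) ^+ 4 + (1 + t) ^+ 4.
Proof.
have -> : (1 - t) ^+ 4 + (1 + t) ^+ 4 = (1 + 6%:R * t ^+ 2 + (t ^+ 2) ^+ 2) *+ 2 by ring.
rewrite t2 /phi_num comp_polyD comp_polyB comp_polyZ comp_Xn_poly comp_polyX comp_polyC.
by rewrite -mul_polyC polyC_natr; ring.
Qed.

Let X1D_comp d : ((1 + 'X) ^+ d : L) \Po 'X^2 = ((1 - t) * (1 + t)) ^+ d.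
Proof.
have -> : (1 - t) * (1 + t) = 1 - t ^+ 2 by ring.
by rewrite t2 opprK rmorphXn /= comp_polyD comp_polyX comp_polyC.
Qed.

Definition shadow_pair M w : L :=
  (1 - I * 'X) ^+ (2 * M - w) * (1 + I * 'X) ^+ w +
  (1 - I * 'X) ^+ w * (1 + I * 'X) ^+ (2 * M - w).

(** Once [((1 - t) (1 + t))^w] is factored out, [a^(2m) + b^(2m)] remains. *)
Lemma shadow_pair_even M w m j : M = (w + 4 * m)%N -> (m <= j)%N ->
  exists2 F, phi_cone M j F & shadow_pair M w = F \Po 'X^2.
Proof.
move=> ME lej.
have [V cV fV] := even_power_sum_cone fp fD m.
exists ((1 + 'X) ^+ (M - 4 * m) * V).
  by apply: hom_cone_phi => //; lia.
rewrite comp_polyM [V \Po _]fV X1D_comp /shadow_pair -/t -!exprM exprMn.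
have -> : (2 * M - w = w + 4 * (2 * m))%N by lia.
have -> : (M - 4 * m = w)%N by lia.
by rewrite !exprD; ring.
Qed.

(** Here [a^(2m+1) + b^(2m+1)] remains, and [a + b] is twice [phi_num] at [y^2]. *)
Lemma shadow_pair_odd M w m j : M = (w + 4 * m + 2)%N -> (m <= j)%N ->
  exists2 F, phi_cone (M - 2) j F & shadow_pair M w = ((phi_num K * F) \Po 'X^2) *+ 2.
Proof.
move=> ME lej.
have [V cV fV] := odd_power_sum_cone fp fD m.
exists ((1 + 'X) ^+ (M - 2 - 4 * m) * V).
  by apply: hom_cone_phi => //; lia.
rewrite !comp_polyM mulrCA -mulrnAr -mulrnAl f_phi [_ * (V \Po _)]fV.
rewrite X1D_comp /shadow_pair -/t -!exprM exprMn.
have -> : (2 * M - w = w + 4 * (2 * m).+1)%N by lia.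
have -> : (M - 2 - 4 * m = w)%N by lia.
by rewrite !exprD; ring.
Qed.

Definition henum m (C : 'M['F_2]_(m, n)) : L := \sum_(c in codewords C) 'X^((wt c)./2).

Lemma wenum_henum m (C : 'M['F_2]_(m, n)) :
  (forall c, c \in codewords C -> ~~ odd (wt c)) -> wenum C = henum C \Po 'X^2.
Proof.
move=> ev; rewrite /henum rmorph_sum; apply: eq_bigr => c /ev evc /=.
by rewrite comp_Xn_poly -exprM mul2n even_halfK.
Qed.

Lemma comp_polyX2_inj : injective (fun p : L => p \Po 'X^2).
Proof.
move=> p q pq; apply/polyP => i; have := congr1 (fun r : L => r`_(i * 2)) pq.
by rewrite /= !coef_comp_poly_Xn // dvdn_mull // mulnK.
Qed.

Hypothesis onesG : (ones n <= G)%MS.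
Variable M : nat.
Hypotheses (nE : n = (2 * M)%N) (rE : (\rank G).+1 = M).

Lemma signr_odd_inj (w v : nat) : (-1) ^+ w = (-1) ^+ v :> L -> odd w = odd v.
Proof.
rewrite -signr_odd -[in RHS]signr_odd; case: (odd w); case: (odd v) => //= /eqP.
  by rewrite eq_sym -addr_eq0 -mulr2n -polyC_natr polyC_eq0 pnatr_eq0.
by rewrite -addr_eq0 -mulr2n -polyC_natr polyC_eq0 pnatr_eq0.
Qed.

Lemma even_wt_dualc v : (v <= dualc G)%MS -> ~~ odd (wt v).
Proof.
move/sub_dualcP/(_ _ onesG) => d0.
by have := @signr_odd_inj (wt v) 0; rewrite -chi_dot_ones d0 chi0 => ->.
Qed.

(** At the all-ones word, of weight [2 M], the shadow condition reads [(-1)^(wt u) (-1)^M = 1]. *)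
Lemma odd_wt_shadow u : u \in shadow -> odd (wt u) = odd M.
Proof.
rewrite inE => /forall_inP/(_ (ones n)); rewrite inE => /(_ onesG)/eqP.
have -> : wt (ones n) = (2 * M)%N.
  rewrite /wt -[RHS]nE -[RHS]card_ord; by apply: eq_card => j; rewrite !inE mxE.
rewrite chi_dot_ones exprM I2 -exprD => H.
by have := @signr_odd_inj (wt u + M) 0 H; rewrite oddD /=; case: odd; case: odd.
Qed.

Lemma shadow_twist_sign u : u \in shadow ->
  I ^+ M * (- I) ^+ wt u = if (wt u == M %[mod 4])%N then 1 else -1.
Proof.
move/odd_wt_shadow => par.
have I4 : I ^+ 4 = 1 by rewrite (exprM _ 2 2) I2 sqrrN expr1n.
have -> : - I = I ^+ 3 by rewrite (exprD _ 2 1) I2 mulN1r.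
rewrite -exprM -exprD -(expr_mod _ I4).
case: ifP => /eqP E.
  by rewrite (_ : (_ %% 4)%N = 0%N) //; lia.
by rewrite (_ : (_ %% 4)%N = 2%N) ?I2 //; lia.
Qed.

Let natr_neq0 (d : nat) : (0 < d)%N -> d%:R != 0 :> L.
Proof. by case: d => // d _; rewrite -polyC_natr polyC_eq0 pnatr_eq0. Qed.

Lemma shadow_sum : \sum_(u in shadow) shadow_term u = (2 ^ M)%:R * (2%:R * wenum G).
Proof.
have r0 : (2 ^ \rank G)%:R != 0 :> L by rewrite natr_neq0 ?expn_gt0.
apply: (mulfI r0); rewrite sum_shadow_term !mulrA -!natrM.
by congr (_%:R * _); rewrite -expnD -expnSr; congr (_ ^ _)%N; move: nE rE; lia.
Qed.

Lemma shadow_twist_sum :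
  \sum_(u in shadow) (if (wt u == M %[mod 4])%N then 1 else -1) * shadow_term u =
  (2 ^ M)%:R * wenum (dualc G).
Proof.
transitivity (\sum_(u in shadow) I ^+ M * ((- I) ^+ wt u * shadow_term u)).
  by apply: eq_bigr => u uS; rewrite -(shadow_twist_sign uS) -mulrA.
rewrite -mulr_sumr sum_shadow_twist mulrA; congr (_ * _).
(* The constant is [2^M] because [i (1 - i)^2 = 2]. *)
have -> : (1 - I) ^+ n = ((1 - I) ^+ 2) ^+ M by rewrite -exprM -nE.
rewrite -exprMn natrX; congr (_ ^+ _).
have -> : I * (1 - I) ^+ 2 = I * (1 + I ^+ 2) - 2%:R * I ^+ 2 by ring.
by rewrite I2; ring.
Qed.

Lemma shadow_sumD : (2 ^ M)%:R * (wenum (dualc G) + 2%:R * wenum G) =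
  2%:R * \sum_(u in shadow | (wt u == M %[mod 4])%N) shadow_term u.
Proof.
rewrite mulrDr -shadow_twist_sum -shadow_sum -big_split /= mulr_sumr big_mkcondr.
by apply: eq_bigr => u _; case: ifP => _; ring.
Qed.

Lemma shadow_sumB : (2 ^ M)%:R * (wenum (dualc G) - 2%:R * wenum G) =
  - (2%:R * \sum_(u in shadow | (wt u != M %[mod 4])%N) shadow_term u).
Proof.
rewrite mulrBr -shadow_twist_sum -shadow_sum -sumrB /= mulr_sumr -sumrN big_mkcondr.
by apply: eq_bigr => u _; case: ifP => _; ring.
Qed.

Lemma shadowD_ones u : (u + ones n \in shadow) = (u \in shadow).
Proof.
rewrite !inE; apply: eq_forallb_in => c; rewrite inE => cG.
by rewrite dotDl (dotG onesG cG) addr0.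
Qed.

Lemma addr_onesK : involutive (fun u : 'rV['F_2]_n => u + ones n).
Proof.
move=> u; apply/rowP => j; rewrite !mxE -addrA.
by rewrite (_ : 1 + 1 = 0) ?addr0 //; apply: val_inj.
Qed.

Lemma shadow_termD_ones u :
  shadow_term u + shadow_term (u + ones n) = shadow_pair M (wt u).
Proof.
have := wt_le u; rewrite /shadow_term wtD_ones /shadow_pair -nE => le.
by rewrite subKn.
Qed.

Lemma shadow_pairC w : (w <= 2 * M)%N -> shadow_pair M (2 * M - w) = shadow_pair M w.
Proof. by move=> le; rewrite /shadow_pair subKn // addrC. Qed.

(** Complementation preserves [wt u = M] modulo 4, so the factor 2 in [shadow_sumD] pairs each [u]
    with its complement, even when [wt u = M]. *)
Lemma even_enum_expansion : exists2 F, phi_cone M (M %/ 4) F &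
  (2 ^ M)%:R * (henum (dualc G) + 2%:R * henum G) = F.
Proof.
have [F cF EF] : exists2 F, phi_cone M (M %/ 4) F &
    (2 ^ M)%:R * (wenum (dualc G) + 2%:R * wenum G) = F \Po 'X^2.
  rewrite shadow_sumD.
  have -> : 2%:R * (\sum_(u in shadow | (wt u == M %[mod 4])%N) shadow_term u) =
      \sum_(u in shadow | (wt u == M %[mod 4])%N) shadow_pair M (wt u).
    under [RHS]eq_bigr do rewrite -shadow_termD_ones.
    rewrite big_split /= mulr_natl mulr2n; congr (_ + _).
    rewrite (reindex_inj (inv_inj addr_onesK)) /=; apply: eq_bigl => u.
    rewrite shadowD_ones wtD_ones; congr (_ && _); have := wt_le u; move: nE.
    by move=> *; apply/eqP/eqP; lia.
  apply: (big_ind (fun x => exists2 F, phi_cone M (M %/ 4) F & x = F \Po 'X^2)).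
  - by exists 0; [exact: phi_cone0 | rewrite comp_poly0].
  - move=> _ _ [F1 c1 ->] [F2 c2 ->]; exists (F1 + F2); first exact: phi_coneD.
    by rewrite comp_polyD.
  move=> u /andP[_ /eqP wM]; have le : (wt u <= 2 * M)%N by rewrite -nE wt_le.
  have [leM|ltM] := leqP (wt u) M.
    by apply: (@shadow_pair_even M (wt u) ((M - wt u) %/ 4)); lia.
  rewrite -shadow_pairC //.
  by apply: (@shadow_pair_even M (2 * M - wt u) ((wt u - M) %/ 4)); lia.
exists F => //; apply: comp_polyX2_inj; rewrite /= -EF.
rewrite !wenum_henum; first last.
- by move=> c; rewrite inE; apply: even_wt_dualc.
- by move=> c; rewrite inE => cG; apply: even_wt_dualc; apply: submx_trans cG soG.
by rewrite -!polyC_natr comp_polyM comp_polyD comp_polyM !comp_polyC.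
Qed.

(** Here [wt u] differs from [M], so each complementary pair has one member of weight below [M]. The
    factor 2 of [shadow_sumB] thus survives and joins the one in [a + b], which leaves [2^(M-2)] on
    the left; the parity argument relies on this 4. *)
Lemma odd_enum_expansion j : (1 < M)%N ->
    (forall u, u \in shadow -> wt u <> M %[mod 4] -> (wt u < M)%N -> (M <= wt u + 4 * j + 2)%N) ->
  exists2 F, phi_cone (M - 2) j F &
  (2 ^ (M - 2))%:R * (henum (dualc G) - 2%:R * henum G) = - (phi_num K * F).
Proof.
move=> M1 hj.
have [F cF EF] : exists2 F, phi_cone (M - 2) j F &
    (2 ^ M)%:R * (wenum (dualc G) - 2%:R * wenum G) =
      - (2%:R * (((phi_num K * F) \Po 'X^2) *+ 2)).
  rewrite shadow_sumB.
  have -> : \sum_(u in shadow | (wt u != M %[mod 4])%N) shadow_term u =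
      \sum_(u in shadow | (wt u != M %[mod 4])%N && (wt u < M)%N) shadow_pair M (wt u).
    under [RHS]eq_bigr do rewrite -shadow_termD_ones.
    rewrite big_split /= (bigID (fun u => (wt u < M)%N)) /=; congr (_ + _).
      by apply: eq_bigl => u; rewrite andbA.
    rewrite (reindex_inj (inv_inj addr_onesK)) /=; apply: eq_bigl => u.
    rewrite shadowD_ones wtD_ones -andbA; congr (_ && _); have := wt_le u; move: nE.
    by move=> *; apply/andP/andP => -[/eqP h1 h2]; split; try apply/eqP; lia.
  suff [F cF ->] : exists2 F, phi_cone (M - 2) j F &
      \sum_(u in shadow | (wt u != M %[mod 4])%N && (wt u < M)%N) shadow_pair M (wt u) =
       ((phi_num K * F) \Po 'X^2) *+ 2 by exists F.
  apply: (big_ind (fun x => exists2 F, phi_cone (M - 2) j F & x = ((phi_num K * F) \Po 'X^2) *+ 2)).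
  - by exists 0; [exact: phi_cone0 | rewrite mulr0 comp_poly0 mul0rn].
  - move=> _ _ [F1 c1 ->] [F2 c2 ->]; exists (F1 + F2); first exact: phi_coneD.
    by rewrite mulrDr comp_polyD mulrnDl.
  move=> u /andP[uS /andP[/eqP wM ltM]].
  have := hj u uS wM ltM; have := odd_wt_shadow uS => par le.
  by apply: (@shadow_pair_odd M (wt u) ((M - wt u) %/ 4)); lia.
exists F => //; apply: comp_polyX2_inj => /=.
have four : 4%:R != 0 :> L by rewrite natr_neq0.
apply: (mulfI four); rewrite [in RHS]rmorphN /=.
move: EF; rewrite !wenum_henum; first last.
- by move=> c; rewrite inE; apply: even_wt_dualc.
- by move=> c; rewrite inE => cG; apply: even_wt_dualc; apply: submx_trans cG soG.
have -> : (2 ^ M = 4 * 2 ^ (M - 2))%N by rewrite -(expnD 2 2) subnKC.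
rewrite natrM -mulrA => EF.
rewrite -[RHS](_ : - (2%:R * (((phi_num K * F) \Po 'X^2) *+ 2)) = _); last by ring.
rewrite -EF; congr (_ * _).
by rewrite -!polyC_natr comp_polyM comp_polyB comp_polyM !comp_polyC.
Qed.

End Shadow.

(** * The bounds *)

Section Coefficients.
Variables (K : numClosedFieldType) (k n : nat) (G : 'M['F_2]_(k, n)).

Lemma henum_mindist m (C : 'M['F_2]_(m, n)) j :
    (forall c, (c <= C)%MS -> c != 0 -> (j < (wt c)./2)%N) ->
  exists r, henum K C = 1 + 'X^(j.+1) * r.
Proof.
move=> hC; rewrite /henum (bigD1 0) /=; last by rewrite inE sub0mx.
have -> : wt (0 : 'rV['F_2]_n) = 0%N by apply: eq_card0 => i; rewrite !inE mxE eqxx.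
rewrite expr0.
exists (\sum_(c in codewords C | c != 0) 'X^((wt c)./2 - j.+1)).
congr (_ + _); rewrite mulr_sumr; apply: eq_bigr => c /andP[cC c0].
by rewrite -exprD subnKC // hC //; rewrite inE in cC.
Qed.

Hypotheses (soG : self_orthogonal G) (onesG : (ones n <= G)%MS).
Variable M : nat.
Hypotheses (nE : n = (2 * M)%N) (rE : (\rank G).+1 = M).

Lemma even_half_gt j (v : 'rV['F_2]_n) : (v <= dualc G)%MS -> (2 * j < wt v)%N -> (j < (wt v)./2)%N.
Proof. by move/(even_wt_dualc K onesG) => ev lt; lia. Qed.

Variable j : nat.
Hypothesis dmin : forall c, (c <= dualc G)%MS -> c != 0 -> (2 * j < wt c)%N.

Lemma enum_low : exists r1 r2, henum K (dualc G) = 1 + 'X^(j.+1) * r1 /\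
   henum K G = 1 + 'X^(j.+1) * r2.
Proof.
have [r1 ->] : exists r, henum K (dualc G) = 1 + 'X^(j.+1) * r.
  by apply: henum_mindist => c cG c0; apply: even_half_gt => //; apply: dmin.
have [r2 ->] : exists r, henum K G = 1 + 'X^(j.+1) * r.
  apply: henum_mindist => c cG c0; have cD := submx_trans cG soG.
  by apply: even_half_gt => //; apply: dmin.
by exists r1, r2.
Qed.

(** Both enumerators are 1 modulo [Y^(j+1)], so their combination is [1 - 2 = -1], which cancels the
    sign of the expansion. *)
Lemma odd_coef_identity i : (1 < M)%N -> (M - 2 <= 6 * j)%N -> (4 * i <= M - 2)%N ->
    (forall u, u \in shadow K G -> wt u <> M %[mod 4] -> (wt u < M)%N ->
       (M <= wt u + 4 * i + 2)%N) ->
  exists e : nat, ((i < j)%N -> e = 0%N) /\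
   (2 ^ (M - 2))%:R * ((1 + 'X) ^+ (6 * j - (M - 2)) * geom2 K j ^+ (2 * j).+1)`_j =
   (- 64%:R) ^+ j * e%:R.
Proof.
move=> M1 leM lei hi.
have [F cF EF] := odd_enum_expansion soG onesG nE rE M1 hi.
have [e [e0 Ee]] := coef_phi_cone leM lei cF.
exists e; split=> //; rewrite -Ee.
have [r1 [r2 [E1 E2]]] := enum_low.
have -> : phi_num K * F = (2 ^ (M - 2))%:R * (1 + 'X^(j.+1) * (2%:R * r2 - r1)).
  by rewrite -[LHS]opprK -EF E1 E2; ring.
rewrite -mulrA -polyC_natr coefCM [(1 + _ * _) * _]mulrC coef_mul1DXn //.
Qed.

(** Now the combination is [1 + 2 = 3]; [phi_num], absent from this expansion, is multiplied in for
    the inversion. *)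
Lemma even_coef_identity : (M <= 6 * j)%N ->
  exists e : nat,
   3%:R * (2 ^ M)%:R * (phi_num K * ((1 + 'X) ^+ (6 * j - M) * geom2 K j ^+ (2 * j).+1))`_j =
   (- 64%:R) ^+ j * e%:R.
Proof.
move=> leM.
have [F cF EF] := even_enum_expansion K soG onesG nE rE.
have leM4 : (4 * (M %/ 4) <= M)%N by lia.
have [e [_ Ee]] := coef_phi_cone leM leM4 cF.
exists e; rewrite -Ee.
have [r1 [r2 [E1 E2]]] := enum_low.
rewrite -EF E1 E2.
set H := _ * geom2 K j ^+ _.
have -> : phi_num K * ((2 ^ M)%:R * (1 + 'X^(j.+1) * r1 + 2%:R * (1 + 'X^(j.+1) * r2))) * H =
  (3 * 2 ^ M)%:R * (phi_num K * H) +
   'X^(j.+1) * ((2 ^ M)%:R * (phi_num K * H) * (r1 + 2%:R * r2)).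
  by rewrite natrM; ring.
by rewrite coefD coefXnM ltnSn addr0 -polyC_natr coefCM natrM.
Qed.

End Coefficients.

(** * Contradictions from sign, parity and sparsity *)

Lemma exp_opp64_odd_le0 (m e : nat) : (- 64%:R) ^+ (2 * m).+1 * e%:R <= 0 :> algC.
Proof.
rewrite exprS exprM sqrrN mulNr mulNr oppr_le0 !mulr_ge0 ?ler0n //.
by rewrite exprn_ge0 // exprn_ge0 // ler0n.
Qed.

Lemma exp_opp64_even (m : nat) : (- 64%:R) ^+ (2 * m) = (2 ^ (12 * m))%:R :> algC.
Proof.
by rewrite exprM sqrrN -natrX -natrX !expnM.
Qed.

Theorem theorem2p1 (k n : nat) (G : 'M['F_2]_(k, n)) :
  semi_self_dual G ->
  ((mindist (dualc G) <= ssd_bound n)%N /\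
   (forall mu : nat, n = (24 * mu)%N ->
      doubly_even G \/ odd 'C(5 * mu - 1, mu - 1) ->
      (mindist (dualc G) <= 4 * mu)%N)).
Proof.
move=> [soG onesG rank2].
have rD : (\rank (dualc G) = n - \rank G)%N by rewrite mxrank_ker mxrank_tr.
pose M := (\rank G).+1.
have nE : n = (2 * M)%N by rewrite /M; lia.
have M1 : (1 < M)%N.
  rewrite /M ltnS lt0n mxrank_eq0; apply/eqP => G0.
  have lt0 : (0 < n)%N by lia.
  move: onesG; rewrite G0 => /submx0null/rowP/(_ (Ordinal lt0)).
  by rewrite !mxE => /eqP; rewrite oner_eq0.
have rE : (\rank G).+1 = M by [].
have dmin b c : (b < mindist (dualc G))%N -> (c <= dualc G)%MS -> c != 0 -> (b < wt c)%N.
  by move=> lt cG c0; apply: leq_trans lt (mindist_le cG c0).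
(* For odd [j = 2 m + 1] a positive coefficient would equal a nonpositive number. The strict
   inequality supplies the factor [1 + X] needed at an odd index. *)
have odd_contra m : (2 * (2 * m).+1 < mindist (dualc G))%N ->
    (M - 2 < 6 * (2 * m).+1)%N -> False.
  move=> /dmin hd leM.
  have hi (u : 'rV['F_2]_n) : u \in shadow algC G -> wt u <> M %[mod 4] -> (wt u < M)%N ->
       (M <= wt u + 4 * ((M - 2) %/ 4) + 2)%N.
    by move=> uS wM ltM; have := odd_wt_shadow onesG nE uS; lia.
  have lei : (4 * ((M - 2) %/ 4) <= M - 2)%N by lia.
  have [e [_ E]] := odd_coef_identity soG onesG nE rE hd M1 (ltnW leM) lei hi.
  have := exp_opp64_odd_le0 m e; rewrite -E lt_geF // mulr_gt0 //.
    by rewrite ltr0n expn_gt0.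
  by apply: coef_X1DX_geom2_gt0; lia.
split.
  rewrite leqNgt; apply/negP; rewrite /ssd_bound; set mu := (n %/ 24)%N.
  case: ifP => h14; last case: ifP => h20 hd.
  (* Residues up to 14 give [M - 2 <= 12 mu + 5 < 6 (2 mu + 1)]. *)
  - move=> hd; apply: (@odd_contra mu); last by lia.
    by rewrite (_ : 2 * (2 * mu).+1 = 4 * mu + 2)%N //; lia.
  (* For [j = 2 mu + 2] the power of -64 is positive, but the coefficient is negative as [6 j - M]
     lies between 2 and 4. *)
  - have hd' : (2 * (2 * mu.+1) < mindist (dualc G))%N by lia.
    have leM : (M <= 6 * (2 * mu.+1))%N by lia.
    have [e E] := even_coef_identity algC soG onesG nE rE (fun c => dmin _ c hd') leM.
    have : (0 : algC) <= (- 64%:R) ^+ (2 * mu.+1) * e%:R.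
      by rewrite exp_opp64_even mulr_ge0 // ler0n.
    rewrite -E lt_geF // pmulr_rlt0 ?coef_phi_num_geom2_lt0 //; first by lia.
    by rewrite mulr_gt0 // ltr0n expn_gt0.
  - by apply: (@odd_contra mu.+1); lia.
move=> mu nmu H; rewrite leqNgt; apply/negP => hd.
have ME : M = (12 * mu)%N by lia.
have mu0 : (0 < mu)%N by lia.
have {}hd : (2 * (2 * mu) < mindist (dualc G))%N by lia.
have leM : (M - 2 <= 6 * (2 * mu))%N by lia.
have dE : (6 * (2 * mu) - (M - 2) = 2)%N by lia.
case: H => [de | oddC].
  (* Shadow words lie in the dual code, since [4] divides [wt c]; zero is excluded because
     [M = 12 mu]. So [wt u >= 4 mu + 2], and the support ends at [2 mu - 1], just before
     [j = 2 mu]. *)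
  have hi (u : 'rV['F_2]_n) : u \in shadow algC G -> wt u <> M %[mod 4] -> (wt u < M)%N ->
       (M <= wt u + 4 * (2 * mu - 1) + 2)%N.
    move=> uS wM ltM; have [u0|u0] := eqVneq u 0.
      case: wM; rewrite u0 ME (_ : wt 0 = 0)%N; first by lia.
      by apply: eq_card0 => i; rewrite !inE mxE eqxx.
    suff /(dmin _ _ hd)/(_ u0) : (u <= dualc G)%MS.
      by have := odd_wt_shadow onesG nE uS; lia.
    apply/sub_dualcP => c cG; move: uS; rewrite inE => /forall_inP/(_ c).
    rewrite inE => /(_ cG); have /dvdnP[q ->] := de c cG.
    rewrite mulnC exprM -polyC_exp (exprM _ 2 2) sqrCi sqrrN expr1n expr1n mulr1.
    by rewrite /chi; case: ifPn => [/eqP //|_]; rewrite eq_sym -addr_eq0 -mulr2n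
      -polyC_natr polyC_eq0 pnatr_eq0.
  have lei : (4 * (2 * mu - 1) <= M - 2)%N by lia.
  have [e [e0 E]] := odd_coef_identity soG onesG nE rE (fun c => dmin _ c hd) M1 leM lei hi.
  have := E; rewrite e0 ?mulr0; last by lia.
  move/eqP; rewrite gt_eqF // mulr_gt0 ?ltr0n ?expn_gt0 //.
  by apply: coef_X1DX_geom2_gt0; lia.
have hi (u : 'rV['F_2]_n) : u \in shadow algC G -> wt u <> M %[mod 4] -> (wt u < M)%N ->
     (M <= wt u + 4 * ((M - 2) %/ 4) + 2)%N.
  by move=> uS wM ltM; have := odd_wt_shadow onesG nE uS; lia.
have lei : (4 * ((M - 2) %/ 4) <= M - 2)%N by lia.
have [e [_]] := odd_coef_identity soG onesG nE rE (fun c => dmin _ c hd) M1 leM lei hi.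
rewrite dE coef_X1D2_geom2 // exp_opp64_even -!natrM => /eqP; rewrite eqr_nat.
(* Cancelling [2^(M-2)] leaves [6 'C(5 mu - 1, mu - 1) = 4 e], which makes the binomial coefficient
   even. *)
have -> : (12 * mu = M - 2 + 2)%N by lia.
rewrite expnD -mulnA eqn_pmul2l ?expn_gt0 // => /eqP.
by move: oddC; move: 'C(_, _); lia.
Qed.
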